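(* Let $X$ and $P$ be nonempty complete metric spaces and let $F:X\times P\to X$ satisfy the following conditions: (a) $F$ is a contraction in $x$ uniformly on bounded sets of $P$, i.e. for every bounded set $B\subset P$ there exists a constant $0\le C<1$ such that $d(F(x,u),F(y,u))\le C\,d(x,y)$ for all $x,y\in X$ and all $u\in B$. (b) For every $x\in X$ the map $F_x:P\to X$, $u\mapsto F(x,u)$, is continuous. (c) For every $x\in X$ the map $F_x:P\to X$ is compact. Then the fixed point map $\Phi:P\to X$, which assigns to each $u\in P$ the unique fixed point of $F(\cdot,u)$, i.e. $\Phi(u)=F(\Phi(u),u)$, is well-defined, continuous and compact. If additionally (d) $F$ is locally Lipschitz in $u$ locally uniformly in $x$, then $\Phi:P\to X$ is also locally Lipschitz.
   Context: All metrics are denoted by $d$. A subset $S$ of a metric space is bounded if there is $r\ge 0$ with $d(x,y)\le r$ for all $x,y\in S$ (boundedness is always in the metric sense). A map $H:P\to Z$ between metric spaces is called compact if it maps bounded sets of $P$ to relatively compact sets of $Z$ (sets with compact closure); compact maps are not assumed continuous. A map $H:P\to Z$ is locally Lipschitz if every $u_0\in P$ has a neighborhood $V$ for which there is $L\ge 0$ with $d(H(v),H(w))\le L\,d(v,w)$ for all $v,w\in V$. The map $F:X\times P\to X$ is locally Lipschitz in $u$ locally uniformly in $x$ if for every $x_0\in X$ and $u_0\in P$ there exist neighborhoods $U\subset X$ of $x_0$ and $V\subset P$ of $u_0$ and a constant $L\ge 0$ such that $d(F(x,v),F(x,w))\le L\,d(v,w)$ for all $x\in U$ and all $v,w\in V$.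 *)

(* Defs.v *)
From HB Require Import structures.
From mathcomp Require Import all_boot all_order all_algebra.
From mathcomp Require Import all_classical all_reals all_analysis.

Set Implicit Arguments.
Unset Strict Implicit.
Unset Printing Implicit Defensive.

Import Order.TTheory GRing.Theory Num.Theory.

Local Open Scope classical_set_scope.
Local Open Scope ring_scope.

(* [completeType] carries a distinguished point, so the spaces below are
   nonempty. Completeness is convergence of Cauchy filters for the metric
   uniformity. *)
#[short(type="completeMetricType")]
HB.structure Definition CompleteMetric (K : numDomainType) :=
  { M of Metric K M & Complete M }.

Section metric_notions.
Context {R : realType}.

(* The library's [bounded_set] needs a norm. *)
Definition metric_bounded (T : metricType R) (S : set T) : Prop :=
  exists2 r : R, 0 <= r & forall x y, S x -> S y -> mdist x y <= r.

Definition compact_map (P Z : metricType R) (H : P -> Z) : Prop :=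
  forall B : set P, metric_bounded B -> compact (closure (H @` B)).

(* The library's [lipschitz_on] also needs a norm. *)
Definition locally_lipschitz (P Z : metricType R) (H : P -> Z) : Prop :=
  forall u0 : P, exists2 V : set P, nbhs u0 V &
    exists2 L : R, 0 <= L &
      forall v w, V v -> V w -> mdist (H v) (H w) <= L * mdist v w.

Definition contraction_unif_bounded (X P : metricType R) (F : X * P -> X) :
    Prop :=
  forall B : set P, metric_bounded B ->
    exists2 C : R, 0 <= C < 1 &
      forall x y u, B u -> mdist (F (x, u)) (F (y, u)) <= C * mdist x y.

Definition locally_lipschitz_locally_unif (X P : metricType R)
    (F : X * P -> X) : Prop :=
  forall (x0 : X) (u0 : P),
    exists U : set X, exists V : set P, [/\ nbhs x0 U, nbhs u0 V &
      exists2 L : R, 0 <= L &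
        forall x v w, U x -> V v -> V w ->
          mdist (F (x, v)) (F (x, w)) <= L * mdist v w].

End metric_notions.

(* Main.v *)
(* A fixed point p of a C-contraction f satisfies (1 - C) d(p, y) <= d(f y, y)
   for every y.  With f = F(., v) and y = Phi u this reduces the continuity and
   the local Lipschitz property of Phi to those of F(Phi u, .).  For
   compactness, an r-net c_1, ..., c_k of Phi(B) yields a (C r + e)-net for any
   e > 0: Phi u = F(Phi u, u) is C r-close to some F(c_i, u), which ranges over
   the totally bounded set F(c_i, B).  Iterating this from a single ball
   containing Phi(B), the radii decrease geometrically to 0, so Phi(B) is
   totally bounded. *)
Require Import Defs.
From HB Require Import structures.
From mathcomp Require Import all_boot all_order all_algebra.
From mathcomp Require Import all_classical all_reals all_analysis.
From mathcomp Require Import finmap ring lra.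

Set Implicit Arguments.
Unset Strict Implicit.
Unset Printing Implicit Defensive.

Import Order.TTheory GRing.Theory Num.Theory.

Local Open Scope classical_set_scope.
Local Open Scope ring_scope.

Lemma exists_geometric_lt (R : realType) (C M e : R) :
  0 <= C < 1 -> 0 < e -> exists n, C ^+ n * M < e.
Proof.
move=> /andP[C0 C1] e0.
have /(cvg_geometric M) : `|C| < 1 by rewrite ger0_norm.
move=> /cvgrPdist_lt/(_ e e0)[N _ /(_ N (leqnn N))] /=.
rewrite sub0r normrN mulrC => N_e.
by exists N; exact: le_lt_trans (ler_norm _) N_e.
Qed.

(** Triangle inequality through [f y], which is within [C * mdist p y] of [f p = p]. *)
Lemma mdist_fixpoint_le (R : realType) (X : metricType R) (f : X -> X) (C : R)
    (p y : X) :
  (forall x y, mdist (f x) (f y) <= C * mdist x y) -> p = f p ->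
  (1 - C) * mdist p y <= mdist (f y) y.
Proof.
move=> fC pE; have := fC p y; rewrite -pE.
have := metric_triangle p (f y) y; lra.
Qed.

Lemma banach_fixed_point_metric (R : realType) (X : completeMetricType R)
    (f : X -> X) (C : R) :
  0 <= C < 1 -> (forall x y, mdist (f x) (f y) <= C * mdist x y) ->
  exists p, p = f p.
Proof.
move=> /andP[C0 C1] fC.
pose x n := iter n f (point : X).
(* [M] is the sum of the geometric series bounding the successive steps; it solves d(x 0, x 1) + C M
   = M, which closes the induction for [x0m]. *)
pose M := mdist (x 0%N) (x 1%N) / (1 - C).
have ME : mdist (x 0%N) (x 1%N) = M - C * M.
  by rewrite /M; field; lra.
have x0m m : mdist (x 0%N) (x m) <= M.
  elim: m => [|m IH].
    by rewrite mdistxx divr_ge0 ?mdist_ge0//; lra.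
  have := fC (x 0%N) (x m); have := ler_wpM2l C0 IH.
  have := metric_triangle (x 0%N) (x 1%N) (x m.+1); rewrite /=; lra.
have xnm n m : mdist (x n) (x (n + m)%N) <= C ^+ n * M.
  elim: n => [|n IH]; first by rewrite mul1r.
  by rewrite addSn (le_trans (fC _ _))// exprS -mulrA ler_wpM2l.
have : cvg (x @ \oo).
  apply: cauchy_cvg; apply: cauchy_exP => e e0.
  have [N N_e] := exists_geometric_lt M (introT andP (conj C0 C1)) e0.
  exists (x N); exists N => // n /= Nn.
  by rewrite ballEmdist /= -(subnKC Nn) (le_lt_trans (xnm _ _)).
move=> /cvg_ex[p xp]; exists p; apply: mdist_positivity.
apply/eqP; rewrite eq_le mdist_ge0 andbT; apply/ler_addgt0Pl => e e0.
have e20 : 0 < e / 2 by lra.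
have [N _ xNp] := (metricType_numDomainType.cvgrPdist_lt _ _).1 xp _ e20.
have /= := xNp N (leqnn N); have /= := xNp N.+1 (leqnSn N).
have := fC p (x N); have := metric_triangle p (x N.+1) (f p).
rewrite (metric_sym (x N.+1)) /=.
have := ler_wpM2r (mdist_ge0 p (x N)) (ltW C1); lra.
Qed.

(** The centres may lie outside [A], so nets of other sets can be reused; a list makes finite unions
    of nets a [flatten]. *)
Definition finite_net (R : realType) (X : metricType R) (A : set X) (r : R) :=
  exists s : seq X, forall x, A x -> exists2 c, c \in s & mdist c x <= r.

Lemma compact_finite_net (R : realType) (X : completeMetricType R) (A : set X)
    (r : R) :
  compact A -> 0 < r -> finite_net A r.
Proof.
rewrite compact_cover => cA r0.
have [||D _ AD] := cA X setT (fun c => (ball c r)^°).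
- by move=> c _; exact: open_interior.
- by move=> c _; exists c => //; exact: nbhsx_ballx.
exists (enum_fset D) => x /AD[c /= cD] /interior_subset.
by rewrite ballEmdist /= => cx; exists c => //; exact: ltW.
Qed.

Lemma ultra_cover_seq (T : Type) (X : eqType) (F : set_system T)
    (FU : UltraFilter F) (g : X -> set T) (s : seq X) :
  F [set x | exists2 c, c \in s & g c x] -> exists c, F (g c).
Proof.
elim: s => [|a s IH] Fs.
  by exfalso; apply: (@filter_not_empty _ F); apply: filterS Fs => x [].
have [Fa|Fa] := in_ultra_setVsetC (g a) FU; first by exists a.
apply: IH; apply: filterS2 Fs Fa => x [c].
by rewrite inE => /orP[/eqP->//|cs gc _]; exists c.
Qed.

(** An ultrafilter on the closure contains a ball of every radius, hence is Cauchy and converges. *)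
Lemma finite_net_compact_closure (R : realType) (X : completeMetricType R)
    (A : set X) :
  (forall r, 0 < r -> finite_net A r) -> compact (closure A).
Proof.
move=> netA; rewrite compact_ultra => F FU FA.
have : cvg F.
  apply: cauchy_cvg; apply: cauchy_exP => e e0.
  (* One third goes from the centre to a point of [A], one from there to the point of the closure;
     the last keeps the inequality strict. *)
  have [s sA] := netA (e / 3) ltac:(lra).
  apply: (@ultra_cover_seq _ _ _ _ (fun c => ball c e) s).
  apply: filterS FA => x /(_ _ (nbhsx_ballx x (e / 3) ltac:(lra)))[y [Ay]].
  rewrite ballEmdist /= => xy; have [c cs cy] := sA y Ay; exists c => //.
  rewrite ballEmdist /=; have := metric_triangle c y x.
  rewrite (metric_sym y); lra.
move=> /cvg_ex[p Fp]; exists p; split => //.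
apply: closed_closure => B pB.
by apply: (@filter_ex _ F); apply: filterI => //; exact: Fp.
Qed.

Theorem theorem2p4 (R : realType) (X P : completeMetricType R)
    (F : X * P -> X)
    (Fcontr : contraction_unif_bounded F)
    (Fcont : forall x : X, continuous (fun u : P => F (x, u)))
    (Fcompact : forall x : X, compact_map (fun u : P => F (x, u))) :
  exists Phi : P -> X,
    [/\ forall u : P, unique (fun x : X => x = F (x, u)) (Phi u),
        continuous Phi,
        compact_map Phi &
        locally_lipschitz_locally_unif F -> locally_lipschitz Phi].
Proof.
(* Unit balls supply a contraction constant valid near each [u]. *)
have bnd_ball (u : P) : metric_bounded (ball u 1).
  exists 2 => // v w; rewrite ballEmdist /= => uv uw.
  have := metric_triangle v u w; rewrite (metric_sym v u); lra.
have /choice[Phi PhiE] (u : P) : exists x, x = F (x, u).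
  have [C C01 FC] := Fcontr _ (bnd_ball u).
  apply: (banach_fixed_point_metric C01) => x y.
  by apply: FC; exact: ballxx.
have Phi_le (B : set P) (C : R) :
    (forall x y u, B u -> mdist (F (x, u)) (F (y, u)) <= C * mdist x y) ->
    forall u y, B u -> (1 - C) * mdist (Phi u) y <= mdist (F (y, u)) y.
  move=> FC u y Bu.
  by apply: (mdist_fixpoint_le (f := fun x => F (x, u))) => // x z; exact: FC.
have Phi_cont : continuous Phi.
  move=> u; have [C /andP[C0 C1] FC] := Fcontr _ (bnd_ball u).
  apply/metricType_numDomainType.cvgrPdist_lt => e e0.
  have e'0 : 0 < (1 - C) * e by rewrite mulr_gt0//; lra.
  have Fu :=
    (metricType_numDomainType.cvgrPdist_lt _ _).1 (Fcont (Phi u) u) _ e'0.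
  rewrite near_simpl; near=> v; have uv : ball u 1 v.
    by near: v; exact: nbhsx_ballx.
  have : mdist (F (Phi u, u)) (F (Phi u, v)) < (1 - C) * e
    by near: v; exact: Fu.
  rewrite -PhiE => Fv.
  have := Phi_le _ _ FC v (Phi u) uv.
  rewrite metric_sym (metric_sym _ (Phi u)) => Pv.
  by have := le_lt_trans Pv Fv; rewrite ltr_pM2l//; lra.
exists Phi; split => //.
- move=> u; split=> // y yE.
  have [C /andP[C0 C1] FC] := Fcontr _ (bnd_ball u).
  have := Phi_le _ _ FC u y (ballxx _ ltr01); rewrite -yE mdistxx => le0.
  apply: mdist_positivity; apply/eqP; rewrite eq_le mdist_ge0 andbT.
  by rewrite -(pmulr_rle0 _ (x := 1 - C))//; lra.
- move=> B bndB; have [C /andP[C0 C1] FC] := Fcontr _ bndB.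
  have netF x e : 0 < e -> finite_net ((fun u => F (x, u)) @` B) e.
    move=> e0; have [s sP] := compact_finite_net (Fcompact x _ bndB) e0.
    by exists s => y By; apply: sP; exact: subset_closure.
  have step r r' : C * r < r' ->
      finite_net (Phi @` B) r -> finite_net (Phi @` B) r'.
    move=> rr' [s sP].
    (* The slack left by [C * r] is the mesh of the nets around each centre. *)
    have /choice[t tP] c := netF c (r' - C * r) ltac:(lra).
    exists (flatten (map t s)) => _ [u Bu <-].
    have [c cs cPhi] := sP _ (ex_intro2 _ _ u Bu erefl).
    have [d dt dF] := tP c _ (ex_intro2 _ _ u Bu erefl).
    exists d; first by apply/flatten_mapP; exists c.
    have := metric_triangle d (F (c, u)) (Phi u).
    have := FC c (Phi u) u Bu; rewrite -PhiE.
    have := ler_wpM2l C0 cPhi; rewrite /= in dF *; lra.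
  pose x0 : X := point.
  have [M M0 netM] : exists2 M, 0 < M & finite_net (Phi @` B) M.
    have [s sP] := netF x0 1 ltr01.
    (* The sum stands in for a maximum: [F (x0, u)] is within 1 + K of [x0], so [Phi u] is within (1
       + K) / (1 - C) of it. *)
    pose K := \sum_(c <- s) mdist c x0.
    have K0 : 0 <= K by apply: sumr_ge0 => c _; exact: mdist_ge0.
    have cK c : c \in s -> mdist c x0 <= K.
      move=> cs; rewrite /K (big_rem c)//= lerDl.
      by apply: sumr_ge0 => ? _; exact: mdist_ge0.
    exists ((1 + K) / (1 - C)); first by rewrite divr_gt0//; lra.
    exists [:: x0] => _ [u Bu <-]; exists x0; first exact: mem_head.
    have [c cs cF] := sP _ (ex_intro2 _ _ u Bu erefl).
    rewrite ler_pdivlMr; last by lra.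
    have := Phi_le _ _ FC u x0 Bu; have := cK _ cs.
    have := metric_triangle (F (x0, u)) c x0.
    rewrite (metric_sym _ c) (metric_sym x0); rewrite /= in cF *; lra.
  (* A ratio strictly between [C] and 1: each use of [step] then has positive slack, and the radii
     still tend to 0. *)
  pose q := (1 + C) / 2.
  have netq n : finite_net (Phi @` B) (q ^+ n * M).
    elim: n => [|n]; first by rewrite mul1r.
    apply: step; rewrite exprS -mulrA ltr_pM2r; first by rewrite /q; lra.
    by rewrite mulr_gt0// exprn_gt0// /q; lra.
  apply: finite_net_compact_closure => r r0.
  have q01 : 0 <= q < 1 by rewrite /q; lra.
  have [N Nr] := exists_geometric_lt M q01 r0.
  have [s sP] := netq N; exists s => x /sP[c cs cx].
  by exists c => //; exact: le_trans cx (ltW Nr).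
- move=> Flip u0; have [C /andP[C0 C1] FC] := Fcontr _ (bnd_ball u0).
  have [U [V [U0 V0 [L L0 FL]]]] := Flip (Phi u0) u0.
  (* [FL] is applied at the point [Phi w], so this must lie in [U]; continuity of [Phi] makes the
     preimage a neighborhood. *)
  exists (ball u0 1 `&` V `&` Phi @^-1` U).
    apply: filterI; last exact: Phi_cont.
    by apply: filterI => //; exact: nbhsx_ballx.
  exists (L / (1 - C)); first by rewrite divr_ge0//; lra.
  move=> v w [[v1 Vv] _] [[w1 Vw] Uw].
  rewrite mulrAC ler_pdivlMr; last by lra.
  have := FL _ _ _ Uw Vv Vw; rewrite -PhiE.
  have := Phi_le _ _ FC v (Phi w) v1; lra.
Unshelve. all: by end_near. Qed.
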